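(* Let $r\ge 0$ be an integer, let $l=r+1$ or $l=r+2$, let $q\ge 1$ be an integer, let $N\ge 1$ be an integer, and let $R>0$ be a real number. Let $\mathcal{D}_x$ be the optimally accurate first-derivative finite-difference operator with stencil $(l,r)$ and $\mathcal{D}_{xx}$ the optimally accurate second-derivative finite-difference operator with centered stencil $q$, and let $\boldsymbol{A},\boldsymbol{B}$ be the corresponding $N\times N$ circulant coefficient matrices. Then the matrix $\boldsymbol{M}=-\boldsymbol{A}+R\boldsymbol{B}$ is semistable.
   Context: The operators discretize the periodic advection-diffusion equation $w_t+w_x-\nu w_{xx}=0$ on $[0,1]$ with $N$ uniform cells, $h=1/N$, $\nu>0$, $R=\nu/h$: $\mathcal{D}_xw_j=\frac1h\sum_{k=-l}^r a_kw_{j+k}$ and $\mathcal{D}_{xx}w_j=\frac1{h^2}\sum_{k=-q}^q b_kw_{j+k}$ (indices modulo $N$). The optimally accurate operators are those with coefficients $$a_k=-\frac{(-1)^k}{k}\frac{l!\,r!}{(l+k)!\,(r-k)!}\ (-l\le k\le r,\ k\neq0),\qquad a_0=-\sum_{-l\le k\le r,\,k\ne0}\frac1k,$$ $$b_k=-\frac{2(-1)^k}{k^2}\frac{q!\,q!}{(q+k)!\,(q-k)!}\ (-q\le k\le q,\ k\ne0),\qquad b_0=-\sum_{k=1}^q\frac{2}{k^2}.$$ Let $\boldsymbol{S}$ be the $N\times N$ cyclic shift matrix, $(\boldsymbol{S}\boldsymbol{W})_j=w_{j+1}$ with indices modulo $N$. Then $\boldsymbol{A}=\sum_{k=-l}^r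 a_k\boldsymbol{S}^k$ and $\boldsymbol{B}=\sum_{k=-q}^q b_k\boldsymbol{S}^k$. A square matrix is semistable if every eigenvalue $\lambda$ satisfies either $\operatorname{Re}\lambda<0$, or $\lambda=0$ and this eigenvalue is regular (semisimple: its algebraic and geometric multiplicities agree). *)

(* Defs.v *)
From HB Require Import structures.
From mathcomp Require Import all_boot all_order all_algebra.
From mathcomp Require Import complex.
From mathcomp Require Import reals.

Set Implicit Arguments.
Unset Strict Implicit.
Unset Printing Implicit Defensive.

Import Order.TTheory GRing.Theory Num.Theory.

Local Open Scope ring_scope.
Local Open Scope complex_scope.

(* The integers -l, -l+1, ..., r. *)
Definition stencil (l r : nat) : seq int :=
  [seq i%:Z - l%:Z | i <- iota 0 (l + r).+1].

(* For k in the stencil, l + k and r - k are nonnegative, so that the absolute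
   values below only convert from int to nat. *)
Definition acoef (K : realType) (l r : nat) (k : int) : K :=
  if k == 0 then - \sum_(i <- stencil l r | i != 0) (i%:~R)^-1
  else - ((-1) ^ k / k%:~R)
       * ((l`! * r`!)%:R / ((absz (l%:Z + k))`! * (absz (r%:Z - k))`!)%:R).

Definition bcoef (K : realType) (q : nat) (k : int) : K :=
  if k == 0 then - \sum_(1 <= i < q.+1) 2 / i%:R ^+ 2
  else - (2 * (-1) ^ k / k%:~R ^+ 2)
       * ((q`! * q`!)%:R / ((absz (q%:Z + k))`! * (absz (q%:Z - k))`!)%:R).

(* (S W)_j = w_(j+1); ordS is the successor modulo the size of the grid, which
   is n.+1 so that square matrices form a ring with integer powers. *)
Definition shift_mx (K : realType) (n : nat) : 'M[K]_n.+1 :=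
  \matrix_(i, j) (j == ordS i)%:R.

Definition advection_mx (K : realType) (l r n : nat) : 'M[K]_n.+1 :=
  \sum_(k <- stencil l r) acoef K l r k *: shift_mx K n ^ k.

Definition diffusion_mx (K : realType) (q n : nat) : 'M[K]_n.+1 :=
  \sum_(k <- stencil q q) bcoef K q k *: shift_mx K n ^ k.

Definition alg_mult (F : fieldType) (n : nat) (M : 'M[F]_n) (z : F) : nat :=
  mup z (char_poly M).

(* eigenspace consists of row vectors; this is harmless, since M and its
   transpose have eigenspaces of the same dimension. *)
Definition geo_mult (F : fieldType) (n : nat) (M : 'M[F]_n) (z : F) : nat :=
  \rank (eigenspace M z).

Definition semistable (K : realType) (n : nat) (M : 'M[K]_n) : Prop :=
  let MC := map_mx (real_complex K) M in
  forall z : K[i], eigenvalue MC z ->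
    complex.Re z < 0 \/ (z = 0 /\ alg_mult MC z = geo_mult MC z).

(* Main.v *)
(* Put t = 2 - x - 1/x = |1 - x|^2 for |x| = 1, and let A(x), B(x) be the
   symbols of the two operators.  Comparing coefficients with the expansion of
   t^m = (-1)^m x^-m (1 - x)^(2m) gives, exactly and not only asymptotically,
     A(x) + A(1/x) = c t^l with c > 0, and B(x) = - \sum_(m < q) c_m t^(m+1)
   with c_m > 0.  The shift matrix is unitary, hence M is diagonalizable with
   eigenvalues - A(x) + R B(x), x running over eigenvalues of the shift; their
   real part is negative unless x = 1, where t = 0 and the eigenvalue is 0. *)
Require Import Defs.
From mathcomp Require Import all_boot all_order all_algebra.
From mathcomp Require Import reals complex spectral ring lra zify.
Import Order.TTheory GRing.Theory Num.Theory.
Local Open Scope ring_scope.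

(** * Sums over stencils and powers of 2 - x - 1/x *)

Lemma natr_fact_neq0 (K : numDomainType) (m : nat) : m`!%:R != 0 :> K.
Proof. by rewrite pnatr_eq0 -lt0n fact_gt0. Qed.

Lemma sum_stencil (V : nmodType) (l r : nat) (F : int -> V) :
  \sum_(k <- stencil l r) F k = \sum_(0 <= i < (l + r).+1) F (i%:Z - l%:Z).
Proof. by rewrite /stencil big_map. Qed.

Lemma mem_stencilP (l r : nat) (k : int) :
  k \in stencil l r -> exists2 i : nat, (i <= l + r)%N & k = i%:Z - l%:Z.
Proof.
by rewrite /stencil => /mapP[j]; rewrite mem_iota => jlr ->; exists j.
Qed.

Lemma sum_stencilSl (V : nmodType) (l r : nat) (F : int -> V) :
  \sum_(k <- stencil l.+1 r) F k = F (- l.+1%:Z) + \sum_(k <- stencil l r) F k.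
Proof.
rewrite !sum_stencil addSn big_nat_recl // add0r; congr (_ + _).
by apply: eq_bigr => i _; congr F; lia.
Qed.

Lemma sum_stencilSr (V : nmodType) (l r : nat) (F : int -> V) :
  \sum_(k <- stencil l r.+1) F k = \sum_(k <- stencil l r) F k + F r.+1%:Z.
Proof.
rewrite !sum_stencil addnS big_nat_recr //=; congr (_ + F _); lia.
Qed.

Lemma sum_stencilN (V : nmodType) (m : nat) (F : int -> V) :
  \sum_(k <- stencil m m) F (- k) = \sum_(k <- stencil m m) F k.
Proof.
rewrite !sum_stencil [RHS]big_nat_rev; apply: eq_big_nat => i Hi.
by congr F; lia.
Qed.

Lemma expN1zN (F : fieldType) (k : int) : (-1) ^ (- k) = (-1) ^ k :> F.
Proof. by rewrite -exprz_inv invrN1. Qed.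

Lemma expr_2BxVx (F : fieldType) (x : F) (m : nat) : x != 0 ->
  (2 - x - x^-1) ^+ m
  = \sum_(k <- stencil m m) ((-1) ^ k * 'C(2 * m, absz (m%:Z + k))%:R) * x ^ k.
Proof.
move=> x0; have -> : 2 - x - x^-1 = - x^-1 * (1 - x) ^+ 2 by field.
rewrite exprMn -exprM exprBn mulr_sumr sum_stencil big_mkord addnn -mul2n.
apply: eq_bigr => i _; rewrite expr1n mulr1.
have -> : absz (m%:Z + (i%:Z - m%:Z)) = i by lia.
rewrite !expfzDr ?oppr_eq0 ?oner_eq0 // expN1zN -!exprnN -!exprnP (exprNn x^-1).
rewrite exprVn -mulr_natr; ring.
Qed.

(** * Closed forms of the coefficients and the symmetrized advection symbol *)

Lemma acoefE (K : realType) (l r i j : nat) : (i + j = l + r)%N -> i != l ->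
  acoef K l r (i%:Z - l%:Z)
  = - ((-1) ^ (i%:Z - l%:Z)%R / (i%:R - l%:R))
       * ((l`! * r`!)%:R / (i`! * j`!)%:R).
Proof.
move=> ij il; rewrite /acoef ifF; last by apply/negbTE; lia.
have -> : absz (l%:Z + (i%:Z - l%:Z)) = i by lia.
have -> : absz (r%:Z - (i%:Z - l%:Z))%R = j by lia.
by rewrite rmorphB.
Qed.

Lemma bcoefE (K : realType) (q i j : nat) : (i + j = 2 * q)%N -> i != q ->
  bcoef K q (i%:Z - q%:Z)
  = - (2 * (-1) ^ (i%:Z - q%:Z)%R / (i%:R - q%:R) ^+ 2)
       * ((q`! * q`!)%:R / (i`! * j`!)%:R).
Proof.
move=> ij iq; rewrite /bcoef ifF; last by apply/negbTE; lia.
have -> : absz (q%:Z + (i%:Z - q%:Z)) = i by lia.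
have -> : absz (q%:Z - (i%:Z - q%:Z))%R = j by lia.
by rewrite rmorphB.
Qed.

Lemma bin_natE (K : realType) (i j : nat) :
  'C(i + j, i)%:R = (i + j)`!%:R / (i`! * j`!)%:R :> K.
Proof.
rewrite -(bin_fact (leq_addr j i)) addKn natrM mulfK //.
by rewrite natrM mulf_neq0 ?natr_fact_neq0.
Qed.

(** Padding with zeros puts A(x) and A(1/x), whose stencils are mirror images, on one symmetric
    stencil, where they can be added term by term. *)
Lemma sum_stencil_widen (V : nmodType) (l r : nat) (F : int -> V) :
  (r <= l)%N ->
  \sum_(k <- stencil l r) F k
  = \sum_(k <- stencil l l) if k <= r%:Z then F k else 0.
Proof.
move=> rl; rewrite !sum_stencil (@big_nat_widen _ _ _ 0 (l + r).+1 (l + l).+1);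
  last by rewrite ltnS leq_add2l.
rewrite big_mkcond; apply: eq_bigr => i _ /=.
by congr (if _ then _ else _); lia.
Qed.

(* The falling factorial j ^_ d, with j = l - k, vanishes exactly for k > r, so
   one formula covers the whole symmetric stencil. *)
Lemma acoef_truncE (K : realType) (r d i j : nat) :
  (i + j = 2 * (r + d))%N -> i != (r + d)%N ->
  (if i%:Z - (r + d)%:Z <= r%:Z then acoef K (r + d) r (i%:Z - (r + d)%:Z)
   else 0)
  = - ((-1) ^ (i%:Z - (r + d)%:Z) / (i%:R - (r + d)%:R))
    * (((r + d)`! * r`!)%:R / (i`! * j`!)%:R) * (j ^_ d)%:R.
Proof.
move=> ij il; have [jd|dj] := ltnP j d.
  by rewrite ffact_small // mulr0 ifF //; apply/negbTE; lia.
rewrite ifT; last by lia.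
rewrite (@acoefE _ _ _ _ (j - d)%N) //; last by lia.
rewrite -(ffact_fact dj) -!mulrA; congr (_ * _); congr (_ * _).
have ffact0 : (j ^_ d)%:R != 0 :> K by rewrite pnatr_eq0 -lt0n ffact_gt0.
by rewrite !natrM; field; rewrite ffact0 !natr_fact_neq0.
Qed.

Lemma sum_stencilV0 (K : realType) (m : nat) :
  \sum_(k <- stencil m m | k != 0) (k%:~R)^-1 = 0 :> K.
Proof.
set s := LHS; suff : s = - s by lra.
rewrite /s [in LHS]big_mkcond -sum_stencilN -big_mkcond /= -sumrN.
rewrite (eq_bigl (fun k => k != 0)) => [|k]; last by rewrite oppr_eq0.
by apply: eq_bigr => k _; rewrite mulrNz invrN.
Qed.

(** The terms 1/k cancel in pairs k, -k, so only the unpaired left end of the stencil survives. *)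
Lemma acoef0_succ (K : realType) (r : nat) : acoef K r.+1 r 0 = r.+1%:R^-1.
Proof.
rewrite /acoef eqxx big_mkcond sum_stencilSl -big_mkcond sum_stencilV0 addr0.
by rewrite mulrNz invrN opprK.
Qed.

Lemma acoef0_succ2 (K : realType) (r : nat) :
  acoef K r.+2 r 0 = r.+1%:R^-1 + r.+2%:R^-1.
Proof.
rewrite /acoef eqxx big_mkcond !sum_stencilSl -big_mkcond sum_stencilV0 addr0.
by rewrite !mulrNz !invrN opprD !opprK addrC.
Qed.

(** The constant c. With d = l - r and i + j = 2 l, the first factor is the quotient of
    [j ^_ d - i ^_ d] by l - i. It equals 2 for d = 1 and 2 (2 l - 1) for d = 2; for d = 3 it would
    already depend on i. *)
Definition advection_const (K : realType) (l r : nat) : K :=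
  (if l == r.+1 then 2 else 2 * (2 * l%:R - 1)) * (l`! * r`!)%:R
  / (2 * l)`!%:R.

(** By [acoef_truncE], the terms at k = i - l and -k = j - l differ only in the sign of 1/k and in
    the falling factorial. Their sum contains [j ^_ d - i ^_ d], which is divisible by k and cancels
    the denominator. The center k = 0 is computed separately from the values of a_0. *)
Lemma acoef_symm (K : realType) (l r : nat) (k : int) :
  l = r.+1 \/ l = r.+2 -> k \in stencil l l ->
  (if k <= r%:Z then acoef K l r k else 0)
  + (if - k <= r%:Z then acoef K l r (- k) else 0)
  = advection_const K l r * ((-1) ^ k * 'C(2 * l, absz (l%:Z + k))%:R).
Proof.
move=> hl /mem_stencilP[i Hi ->].
have [j ij] : exists j, (i + j = 2 * l)%N by exists (2 * l - i)%N; lia.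
have -> : absz (l%:Z + (i%:Z - l%:Z)) = i by lia.
rewrite /advection_const -{2}ij bin_natE ij.
(* field would unfold (2 * l)`!, hence the generalization. *)
move: ((2 * l)`!%:R) (natr_fact_neq0 K (2 * l)%N) => w w0.
have [eil|nil] := eqVneq i l.
  have -> : j = l by lia.
  rewrite eil subrr oppr0 expr0z lez_nat leq0n.
  case: hl => el.
    rewrite el eqxx acoef0_succ (factS r) !natrM; field.
    by rewrite w0 !natr_fact_neq0 nat1r !pnatr_eq0.
  have -> : (l == r.+1) = false by apply/negbTE; lia.
  rewrite el acoef0_succ2 (factS r.+1) (factS r) !natrM; field.
  by rewrite w0 !natr_fact_neq0 -natrD nat1r !pnatr_eq0.
have -> : - (i%:Z - l%:Z) = (j%:Z - l%:Z) by lia.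
have kN0 : i%:R - l%:R != 0 :> K by rewrite subr_eq0 eqr_nat.
have jE : j%:R = 2 * l%:R - i%:R :> K.
  by rewrite -natrM -ij natrD addrC addKr.
have jl : j%:R - l%:R = - (i%:R - l%:R) :> K by rewrite jE; ring.
have expj : (-1) ^ (j%:Z - l%:Z) = (-1) ^ (i%:Z - l%:Z) :> K.
  by rewrite -expN1zN; congr (_ ^ _); lia.
case: hl => el.
  have el1 : l = (r + 1)%N by lia.
  rewrite [in LHS]el1 (@acoef_truncE _ _ _ i j) -?el1 //.
  rewrite [in X in _ + X]el1 (@acoef_truncE _ _ _ j i) -?el1 //; try lia.
  rewrite el eqxx -el !ffactn1 expj jl !natrM jE; field.
  by rewrite w0 !natr_fact_neq0 kN0.
have el1 : l = (r + 2)%N by lia.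
rewrite [in LHS]el1 (@acoef_truncE _ _ _ i j) -?el1 //.
rewrite [in X in _ + X]el1 (@acoef_truncE _ _ _ j i) -?el1 //; try lia.
have ffact2 m : (m ^_ 2)%:R = m%:R * (m%:R - 1) :> K.
  by case: m => [|m]; rewrite ffactnS ?ffactn1 ?mul0r // natrM -natr1 addrK.
have -> : (l == r.+1) = false by apply/negbTE; lia.
rewrite !ffact2 expj jl !natrM jE; field.
by rewrite w0 !natr_fact_neq0 kN0.
Qed.

(** Reindexing the second sum by k -> -k makes [acoef_symm] the comparison of the coefficients of
    x^k. The morphism [f] allows real coefficients with complex x. *)
Lemma advection_symbolD (K : realType) (F : fieldType)
    (f : {rmorphism K -> F}) (l r : nat) (x : F) :
  l = r.+1 \/ l = r.+2 -> x != 0 ->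
  \sum_(k <- stencil l r) f (acoef K l r k) * x ^ k
  + \sum_(k <- stencil l r) f (acoef K l r k) * x^-1 ^ k
  = f (advection_const K l r) * (2 - x - x^-1) ^+ l.
Proof.
move=> hl x0; have rl : (r <= l)%N by lia.
rewrite !(@sum_stencil_widen _ l r) // -[X in _ + X = _]sum_stencilN -big_split.
rewrite expr_2BxVx // mulr_sumr big_seq [RHS]big_seq /=.
apply: eq_bigr => k kl.
rewrite exprz_inv opprK mulrA.
have -> : (-1) ^ k * 'C(2 * l, absz (l%:Z + k))%:R
    = f ((-1) ^ k * 'C(2 * l, absz (l%:Z + k))%:R).
  by rewrite rmorphM fmorphXz rmorphN1 rmorph_nat.
rewrite -rmorphM -acoef_symm // rmorphD mulrDl.
by congr (_ + _); case: ifP => _; rewrite ?rmorph0 ?mul0r.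
Qed.

(** * The diffusion symbol as a polynomial in 2 - x - 1/x *)

Definition diffusion_const (K : realType) (q : nat) : K :=
  2 * (q`! * q`!)%:R / (2 * q.+1)`!%:R.

(** These are the two ends of the stencil that are new at width q + 1; there the whole coefficient
    comes from the new power of t. *)
Lemma bcoef_last (K : realType) (q i : nat) : i = 0%N \/ i = (2 * q.+1)%N ->
  bcoef K q.+1 (i%:Z - q.+1%:Z)
  = - diffusion_const K q * ((-1) ^ (i%:Z - q.+1%:Z) * 'C(2 * q.+1, i)%:R).
Proof.
move=> hi; have -> : 'C(2 * q.+1, i)%:R = 1%:R :> K.
  by case: hi => ->; rewrite ?bin0 ?binn.
rewrite (@bcoefE _ _ i (2 * q.+1 - i)%N); [|lia|lia].
have -> : (i`! * (2 * q.+1 - i)`!)%:R = (2 * q.+1)`!%:R :> K.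
  by case: hi => ->; rewrite ?subn0 ?subnn fact0 ?mul1n ?muln1.
have -> : (i%:R - q.+1%:R) ^+ 2 = q.+1%:R ^+ 2 :> K.
  by case: hi => ->; rewrite ?natrM; ring.
rewrite /diffusion_const.
move: ((2 * q.+1)`!%:R) (natr_fact_neq0 K (2 * q.+1)) => w w0.
rewrite factS !natrM; field.
by rewrite w0 nat1r pnatr_eq0.
Qed.

(** Over a common denominator, the difference for i + j = 2 q and k = i - q contains (q + 1)^2 - (i
    + 1) (j + 1) = k^2, which cancels the factor 1/k^2. At k = 0 the difference is the last term of
    the sum defining b_0. *)
Lemma bcoefS (K : realType) (q : nat) (k : int) : k \in stencil q q ->
  bcoef K q.+1 k = bcoef K q k
    - diffusion_const K q * ((-1) ^ k * 'C(2 * q.+1, absz (q.+1%:Z + k))%:R).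
Proof.
move=> /mem_stencilP[i Hi ->].
have [j ij] : exists j, (i + j = 2 * q)%N by exists (2 * q - i)%N; lia.
have -> : absz (q.+1%:Z + (i%:Z - q%:Z)) = i.+1 by lia.
have ij1 : (i.+1 + j.+1 = 2 * q.+1)%N by lia.
rewrite /diffusion_const -{2}ij1 bin_natE ij1.
move: ((2 * q.+1)`!%:R) (natr_fact_neq0 K (2 * q.+1)%N) => w w0.
have [eiq|niq] := eqVneq i q.
  have -> : j = q by lia.
  rewrite eiq subrr expr0z /bcoef eqxx big_nat_recr //= factS !natrM; field.
  by rewrite w0 natr_fact_neq0 nat1r pnatr_eq0.
rewrite (@bcoefE _ q i j) //.
have -> : i%:Z - q%:Z = i.+1%:Z - q.+1%:Z by lia.
rewrite (@bcoefE _ q.+1 i.+1 j.+1) //.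
have iq0 : i%:R - q%:R != 0 :> K by rewrite subr_eq0 eqr_nat.
have jE : j%:R = 2 * q%:R - i%:R :> K.
  by rewrite -natrM -ij natrD addrC addKr.
have i1E : i.+1%:R - q.+1%:R = i%:R - q%:R :> K by rewrite -!natr1; ring.
have i10 : 1 + i%:R != 0 :> K by rewrite nat1r pnatr_eq0.
have j10 : 1 + (2 * q%:R - i%:R) != 0 :> K by rewrite -jE nat1r pnatr_eq0.
rewrite i1E (factS i) (factS j) (factS q) !natrM -!nat1r jE; field.
by rewrite w0 !natr_fact_neq0 iq0 i10 j10.
Qed.

Lemma diffusion_symbolS (K : realType) (F : fieldType)
    (f : {rmorphism K -> F}) (q : nat) (x : F) : x != 0 ->
  \sum_(k <- stencil q.+1 q.+1) f (bcoef K q.+1 k) * x ^ k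
  = \sum_(k <- stencil q q) f (bcoef K q k) * x ^ k
    - f (diffusion_const K q) * (2 - x - x^-1) ^+ q.+1.
Proof.
move=> x0; rewrite expr_2BxVx // mulr_sumr.
(* The coefficient of x^k in the new power of t, kept in [K] so that the coefficient identities
   apply under [f]. *)
pose g k : K :=
  diffusion_const K q * ((-1) ^ k * 'C(2 * q.+1, absz (q.+1%:Z + k))%:R).
rewrite [X in _ - X](eq_bigr (fun k => f (g k) * x ^ k)); last first.
  move=> k _; rewrite mulrA; congr (_ * _).
  by rewrite /g rmorphM [f (_ ^ _ * _)]rmorphM fmorphXz rmorphN1 rmorph_nat.
rewrite !sum_stencilSl !sum_stencilSr.
have -> : bcoef K q.+1 (- q.+1%:Z) = - g (- q.+1%:Z).
  have := @bcoef_last K q 0 (or_introl erefl); rewrite sub0r => ->.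
  by rewrite /g mulNr subrr.
have -> : bcoef K q.+1 q.+1%:Z = - g q.+1%:Z.
  have := @bcoef_last K q _ (or_intror erefl).
  have -> : (2 * q.+1)%:Z - q.+1%:Z = q.+1%:Z by lia.
  move=> ->; rewrite /g mulNr.
  by have -> : absz (q.+1%:Z + q.+1%:Z) = (2 * q.+1)%N by lia.
have -> : \sum_(k <- stencil q q) f (bcoef K q.+1 k) * x ^ k
    = \sum_(k <- stencil q q) f (bcoef K q k) * x ^ k
      - \sum_(k <- stencil q q) f (g k) * x ^ k.
  rewrite -sumrB big_seq [RHS]big_seq; apply: eq_bigr => k kq.
  by rewrite bcoefS // rmorphB mulrBl.
rewrite !rmorphN; ring.
Qed.

(** For x = e^(i theta), t = 4 sin^2(theta/2), and the right-hand sum consists of the first q terms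
    of the expansion of theta^2 in powers of t. *)
Lemma diffusion_symbolE (K : realType) (F : fieldType)
    (f : {rmorphism K -> F}) (q : nat) (x : F) : x != 0 ->
  \sum_(k <- stencil q q) f (bcoef K q k) * x ^ k
  = - \sum_(m < q) f (diffusion_const K m) * (2 - x - x^-1) ^+ m.+1.
Proof.
move=> x0; elim: q => [|q IHq].
  rewrite big_ord0 /stencil big_seq1 /bcoef /= big_geq // !oppr0.
  by rewrite rmorph0 mul0r.
by rewrite diffusion_symbolS // IHq big_ord_recr opprD.
Qed.

(** * Multiplicities of eigenvalues of diagonalizable matrices *)

Lemma mxrank_diag (F : fieldType) (n : nat) (d : 'rV[F]_n) :
  \rank (diag_mx d) = #|[pred j | d 0 j != 0]|.
Proof.
(* The row space is a direct sum of coordinate lines, one for each nonzero diagonal entry. *)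
pose U := (\sum_(j | d 0 j != 0%R) <<delta_mx 0 j : 'rV[F]_n>>)%MS.
have rowd j : row j (diag_mx d) = d 0 j *: delta_mx 0 j.
  by rewrite row_diag_mx.
have -> : \rank (diag_mx d) = \rank U.
  apply: eqmx_rank; apply/andP; split.
    apply/row_subP => j; rewrite rowd.
    have [->|dj] := eqVneq (d 0 j) 0; first by rewrite scale0r sub0mx.
    by rewrite scalemx_sub // (sumsmx_sup j) // genmxE.
  apply/sumsmx_subP => j dj; rewrite genmxE.
  by rewrite -(eqmx_scale _ dj) -rowd row_sub.
have /mxdirectP -> : mxdirect U by apply: mxdirect_delta => j k _ _.
rewrite /= -sum1_card; apply: eq_bigr => j _.
by rewrite genmxE mxrank_delta.
Qed.

(** In polynomial matrices, P (X - M) = (X - D) P, and the nonzero constant det P cancels from the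
    determinants. *)
Lemma char_poly_diag_conj (F : fieldType) (n : nat) (P M : 'M[F]_n)
    (d : 'rV[F]_n) :
  P \in unitmx -> P *m M = diag_mx d *m P ->
  char_poly M = \prod_j ('X - (d 0 j)%:P).
Proof.
move=> uP PM; have detP : \det (map_mx polyC P) != 0.
  by rewrite det_map_mx polyC_eq0 -unitfE -unitmxE.
apply: (mulfI detP); rewrite -det_mulmx mulmxBr -map_mxM PM map_mxM.
rewrite scalar_mxC -mulmxBl det_mulmx mulrC; congr (_ * _).
have := @char_poly_trig F n (diag_mx d).
rewrite /char_poly => ->; last exact: diag_mx_is_trig.
by apply: eq_bigr => j _; rewrite mxE eqxx mulr1n.
Qed.

(** Both multiplicities count the indices j with [d 0 j = z]: one as roots of the characteristic
    polynomial, the other as the nullity of D - z. *)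
Lemma alg_mult_diag_conj (F : fieldType) (n : nat) (P M : 'M[F]_n)
    (d : 'rV[F]_n) (z : F) :
  P \in unitmx -> P *m M = diag_mx d *m P -> alg_mult M z = geo_mult M z.
Proof.
move=> uP PM; rewrite /alg_mult (char_poly_diag_conj _ _ _ _ _ uP PM).
transitivity #|[pred j | d 0 j == z]|.
  rewrite -(big_map (d 0) xpredT (fun y => 'X - y%:P)) mu_prod_XsubC.
  by rewrite count_map -sum1_count -sum1_card.
have PMz : P *m (M - z%:M) = diag_mx (d - const_mx z) *m P.
  by rewrite mulmxBr PM scalar_mxC -mulmxBl -diag_const_mx linearB.
rewrite /geo_mult mxrank_ker -[\rank (M - _)](eqmxMfull _ (_ : row_full P));
  last by rewrite row_full_unit.
rewrite PMz mxrankMfree ?row_free_unit // mxrank_diag.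
apply: (canRL (addnK _)); rewrite -[RHS]card_ord -(cardC [pred j | d 0 j == z]).
by congr (_ + _)%N; apply: eq_card => j; rewrite !inE !mxE subr_eq0.
Qed.

(** * Integer powers and the spectrum of the shift matrix *)

Lemma row_eigenXz (F : fieldType) (n : nat) (S : 'M[F]_n.+1)
    (v : 'rV[F]_n.+1) (w : F) (k : int) :
  S \is a GRing.unit -> w != 0 -> v *m S = w *: v -> v *m S ^ k = w ^ k *: v.
Proof.
move=> uS w0 vS; have vSn (m : nat) : v *m S ^+ m = w ^+ m *: v.
  elim: m => [|m IHm]; first by rewrite !expr0 mulmx1 scale1r.
  by rewrite exprS mulmxA vS -scalemxAl IHm scalerA exprS.
case: k => m; first exact: vSn.
rewrite NegzE -!exprnN; set a := m.+1; apply: (canRL (scalerK _)).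
  by rewrite expf_neq0.
rewrite scalemxAl -vSn -mulmxA.
by rewrite [S ^+ a *m _]mulrV ?unitrX // mulmx1.
Qed.

Lemma shift_unitary (K : realType) (n : nat) :
  map_mx (real_complex K) (shift_mx K n) \is unitarymx.
Proof.
apply/unitarymxP/matrixP => i k; rewrite !mxE (bigD1 (ordS i)) //= !mxE eqxx.
rewrite mul1r big1 ?addr0 => [|j ji]; last by rewrite !mxE (negbTE ji) mul0r.
rewrite (inj_eq (@ordS_inj _)) eq_sym.
by case: eqP; rewrite ?conjC1 ?conjC0.
Qed.

(** The spectral theorem replaces an explicit Fourier basis: P is unitary, so D = P S P^-1 is
    unitary too and its diagonal entries have modulus 1. *)
Lemma shift_eigenbasis (K : realType) (n : nat) :
  exists (P : 'M[K[i]]_n.+1) (d : 'rV[K[i]]_n.+1),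
    [/\ P \in unitmx,
        P *m map_mx (real_complex K) (shift_mx K n) = diag_mx d *m P &
        forall j, d 0 j * conjc (d 0 j) = 1].
Proof.
set S := map_mx _ _; have uS : S \is unitarymx by exact: shift_unitary.
have normS : S \is normalmx.
  apply/normalmxP; move/unitarymxP: (uS) => SSt; rewrite SSt.
  by move: uS; rewrite -trmxC_unitary => /unitarymxP; rewrite trmxCK => ->.
have /orthomx_spectralP := normS.
set P := spectralmx S; set d := spectral_diag S => SE.
have uP : P \is unitarymx by exact: spectral_unitarymx.
have PS : P *m S = diag_mx d *m P.
  by rewrite {1}SE !mulmxA mulmxV ?unitarymx_unit // mul1mx.
exists P, d; split; [exact: unitarymx_unit|exact: PS|move=> j].
have : diag_mx d \is unitarymx.
  have -> : diag_mx d = P *m S *m invmx P.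
    by rewrite PS mulmxK // unitarymx_unit.
  by rewrite invmx_unitary // !mul_unitarymx // trmxC_unitary.
move=> /unitarymxP; rewrite tr_diag_mx map_diag_mx mulmx_diag.
by move=> /matrixP/(_ j j); rewrite !mxE eqxx !mulr1n.
Qed.

(** * The sign of the real part of the symbol on the unit circle *)

Lemma advection_const_gt0 (K : realType) (l r : nat) :
  l = r.+1 \/ l = r.+2 -> 0 < advection_const K l r.
Proof.
move=> hl; rewrite /advection_const divr_gt0 ?ltr0n ?fact_gt0 //.
rewrite mulr_gt0 ?ltr0n ?muln_gt0 ?fact_gt0 //; case: ifP => // _.
rewrite mulr_gt0 // subr_gt0 -natrM ltr1n; lia.
Qed.

Lemma diffusion_const_gt0 (K : realType) (q : nat) : 0 < diffusion_const K q.
Proof. by rewrite !mulr_gt0 ?invr_gt0 ?ltr0n ?muln_gt0 ?fact_gt0. Qed.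

Definition symbol (K : realType) (l r q : nat) (R : K) (x : K[i]) : K[i] :=
  - (\sum_(k <- stencil l r) real_complex K (acoef K l r k) * x ^ k)
  + real_complex K R
    * \sum_(k <- stencil q q) real_complex K (bcoef K q k) * x ^ k.

Lemma conjc_symbol (K : realType) (l r q : nat) (R : K) (x : K[i]) :
  conjc (symbol K l r q R x) = symbol K l r q R (conjc x).
Proof.
have conj_sum (s : seq int) (g : int -> K) :
    conjc (\sum_(k <- s) real_complex K (g k) * x ^ k)
    = \sum_(k <- s) real_complex K (g k) * conjc x ^ k.
  rewrite rmorph_sum; apply: eq_bigr => k _.
  by rewrite rmorphM fmorphXz /= oppr0.
by rewrite /symbol -!conj_sum rmorphD rmorphN rmorphM /= oppr0.
Qed.

(** The coefficients are real and conj x = 1/x, so the conjugate is the symbol at 1/x. Since t is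
    invariant under x -> 1/x, the diffusion part is merely doubled. *)
Lemma symbolD_conj (K : realType) (l r q : nat) (R : K) (x : K[i]) :
  l = r.+1 \/ l = r.+2 -> x * conjc x = 1 ->
  symbol K l r q R x + conjc (symbol K l r q R x)
  = - (real_complex K (advection_const K l r) * (2 - x - x^-1) ^+ l
       + real_complex K R * 2
         * \sum_(m < q) real_complex K (diffusion_const K m)
                        * (2 - x - x^-1) ^+ m.+1).
Proof.
move=> hl xx; have x0 : x != 0.
  by apply: contra_eq_neq xx => ->; rewrite mul0r eq_sym oner_eq0.
have xV : conjc x = x^-1 by rewrite -[LHS](mulKf x0) xx mulr1.
have xV0 : x^-1 != 0 by rewrite invr_eq0.
rewrite -(advection_symbolD K _ (real_complex K) l r) //.
rewrite conjc_symbol xV /symbol.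
rewrite !(diffusion_symbolE K _ (real_complex K)) // invrK.
have -> : 2 - x^-1 - x = 2 - x - x^-1 by rewrite addrAC.
ring.
Qed.

(** At x = 1, t = 0 makes the symbol plus its conjugate vanish, and the symbol equals its own
    conjugate there. *)
Lemma symbol1 (K : realType) (l r q : nat) (R : K) :
  l = r.+1 \/ l = r.+2 -> symbol K l r q R 1 = 0.
Proof.
move=> hl; have := symbolD_conj K l r q R 1 hl.
rewrite rmorph1 mulr1 invr1 => /(_ erefl).
have -> : 2 - 1 - 1 = 0 :> K[i] by ring.
rewrite big1 => [|m _]; last by rewrite expr0n mulr0.
rewrite expr0n; have -> : (l == 0)%N = false by apply/negbTE; lia.
rewrite !mulr0 addr0 oppr0.
rewrite conjc_symbol rmorph1 => /eqP.
by rewrite -mulr2n mulrn_eq0 => /eqP.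
Qed.

Lemma Re_symbol_lt0 (K : realType) (l r q : nat) (R : K) (x : K[i]) :
  l = r.+1 \/ l = r.+2 -> (1 <= q)%N -> 0 < R -> x * conjc x = 1 -> x != 1 ->
  complex.Re (symbol K l r q R x) < 0.
Proof.
move=> hl; case: q => // q _ R0 xx x1.
have x0 : x != 0.
  by apply: contra_eq_neq xx => ->; rewrite mul0r eq_sym oner_eq0.
have t0 : 0 < 2 - x - x^-1.
  have -> : 2 - x - x^-1 = (1 - x) * conjc (1 - x).
    have xV : conjc x = x^-1 by rewrite -[LHS](mulKf x0) xx mulr1.
    rewrite (_ : conjc _ = 1 - x^-1); first by field.
    by rewrite -xV rmorphB rmorph1.
  by rewrite mul_conjC_gt0 subr_eq0 eq_sym.
have f0 (a : K) : 0 < a -> 0 < real_complex K a by rewrite ltcR.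
(* The order on [K[i]] compares real parts and requires equal imaginary parts; the sum is twice the
   real part. *)
suff : symbol K l r q.+1 R x + conjc (symbol K l r q.+1 R x) < 0.
  by case: (symbol _ _ _ _ _ _) => a b; rewrite ltcE /= => /andP[_]; lra.
rewrite symbolD_conj // oppr_lt0 addr_gt0 //.
  by rewrite mulr_gt0 ?exprn_gt0 // f0 // advection_const_gt0.
(* The term m = 0 is present because the stencil width is positive, and it gives strictness; the
   other terms need only be nonnegative. *)
rewrite !mulr_gt0 ?f0 // big_ord_recl ltr_wpDr //.
  apply: sumr_ge0 => m _.
  by rewrite mulr_ge0 ?exprn_ge0 ?(ltW t0) // ltW // f0 // diffusion_const_gt0.
by rewrite mulr_gt0 ?exprn_gt0 // f0 // diffusion_const_gt0.
Qed.

(** * Diagonalization of M in the eigenbasis of the shift *)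

Theorem theorem3p4 (K : realType) (r l q n : nat) (R : K)
    (hl : l = r.+1 \/ l = r.+2) (hq : (1 <= q)%N) (hR : 0 < R) :
  semistable (- advection_mx K l r n + R *: diffusion_mx K q n).
Proof.
have [P [d [uP PS d1]]] := shift_eigenbasis K n.
rewrite /semistable; set M := - _ + _; set S := shift_mx K n in PS.
pose e := \row_j symbol K l r q R (d 0 j).
have uS : S \is a GRing.unit.
  have := unitarymx_unit (shift_unitary K n).
  by rewrite map_unitmx.
(* The rows of [P] are left eigenvectors of [S], hence of all its integer powers, and so of every
   combination of these. *)
have rowS j (k : int) :
    row j P *m map_mx (real_complex K) (S ^ k) = d 0 j ^ k *: row j P.
  rewrite rmorphXz //; apply: row_eigenXz.
  - by rewrite rmorph_unit.
  - by apply: contra_eq_neq (d1 j) => ->; rewrite mul0r eq_sym oner_eq0.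
  - by rewrite -row_mul PS row_mul row_diag_mx -scalemxAl -rowE.
have row_sum j s (g : int -> K) :
    row j P *m map_mx (real_complex K) (\sum_(k <- s) g k *: S ^ k)
    = (\sum_(k <- s) real_complex K (g k) * d 0 j ^ k) *: row j P.
  rewrite rmorph_sum mulmx_sumr scaler_suml /=; apply: eq_bigr => k _.
  by rewrite map_mxZ -scalemxAr rowS scalerA.
have PM : P *m map_mx (real_complex K) M = diag_mx e *m P.
  apply/row_matrixP => j; rewrite !row_mul row_diag_mx -scalemxAl -rowE mxE.
  rewrite map_mxD map_mxN map_mxZ mulmxDr mulmxN -scalemxAr !row_sum.
  by rewrite scalerA -scaleNr -scalerDl.
move=> z; rewrite eigenvalue_root_char (char_poly_diag_conj _ _ _ _ _ uP PM).
rewrite -(big_map (e 0) xpredT (fun y => 'X - y%:P)) root_prod_XsubC.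
move=> /mapP[j _ ->]; rewrite mxE.
(* Only the shift eigenvalue 1 leads to the eigenvalue 0 of M; every other one gives a negative real
   part. *)
have [->|dj] := eqVneq (d 0 j) 1; last by left; exact: Re_symbol_lt0.
right; rewrite symbol1 //; split=> //.
exact: alg_mult_diag_conj uP PM.
Qed.
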